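(* Let $n\in\mathbb{N}$ be such that $$W_{n}=\{\langle m,gn(\phi)\rangle\in\mathbb{N} : \phi \text{ is a formula with } FV(\phi)\subseteq\{x\} \text{ and } S'_{n0}\models\phi(x|\overline{m})\},$$ where $\phi(x|\overline{m})$ is the result of substituting the numeral $\overline m$ for $x$ in $\phi$. Then $S_n$ is $\omega$-consistent. (The systems $S_n$ and $S'_{n0}$ are defined in the context.)
   Context: Language of Epistemic Arithmetic: the language of Peano Arithmetic (PA) extended by a modal operator $K$; if $\phi$ is a formula then so is $K(\phi)$, with the same free variables. $FV(\phi)$ is the set of free variables of $\phi$. If $\phi$ has free variables exactly $x_1,\ldots,x_k$, a universal closure of $\phi$ is $\forall x_1\cdots\forall x_k\,\phi$. The axioms of Epistemic Arithmetic are the (universally closed) axioms of PA with the induction schema extended to all formulas of this modal language. Semantics (Carlson's base logic): a structure consists of a first-order structure $\mathscr{N}$ for the first-order part together with a function assigning True or False to each pair of a formula $K(\phi)$ and a variable assignment $s$ (written $\mathscr{N}\models K(\phi)[s]$ when True), such that: (a) the value does not depend on $s(x)$ if $x$ is not free in $\phi$; (b) the value is the same for $K(\phi)$ and $K(\psi)$ if $\phi,\psi$ differ only by renaming bound variables; (c) if the variable $y$ is substitutable for $x$ in $K(\phi)$, then $\mathscr{N}\models K(\phi)(x|y)[s]$ iff $\mathscr{N}\models K(\phi)[s(x|s(y))]$. Truth of other formulas is defined as usual. A formula is valid if true in every structure under every assignment. For a set $T$ of sentences, $T\models\phi$ means $\phi$ is true in every structure satisfying $T$. $W_e$ is the $e$th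 r.e. set, $\langle\cdot,\cdot\rangle:\mathbb{N}^2\to\mathbb{N}$ is a canonical computable pairing function, $gn(\phi)$ is the Gödel number of $\phi$, $x$ is a fixed variable, and $\langle x,\ulcorner\phi\urcorner\rangle\in W_{\overline n}$ abbreviates a formula of the language of PA, with free variable $x$, saying $\langle x,gn(\phi)\rangle\in W_n$. For a formula $\phi$ and an assignment $s$ (of natural numbers to variables), $\phi^s$ is the sentence obtained by replacing every free variable $y$ of $\phi$ by the numeral $\overline{s(y)}$. $S_n$ is the system: (1a) (Global) universal closures of $K(\phi\rightarrow\psi)\rightarrow (K(\phi)\rightarrow K(\psi))$; (1b) (Local) universal closures of $K(\phi)\rightarrow\phi$; (1c) (Global) universal closures of $K(\phi)\rightarrow K(K(\phi))$; (1d) the rule of global necessitation for $K$; (2) (Global) the axioms of Epistemic Arithmetic; (3) (Global, ''Having Code $n$'') $\forall x(K(\phi)\leftrightarrow\langle x,\ulcorner\phi\urcorner\rangle\in W_{\overline n})$ for each $\phi$ whose lone free variable is $x$. $S_n\models\phi$ means that there is a finite sequence $\phi_1,\ldots,\phi_m$ with $\phi_m=\phi$ such that for each $i$: (i) $\phi_i$ is a local axiom, or (ii) $\phi_i$ is a global axiom, or (iii) $\phi_i$ is valid, or (iv) $\phi_i$ follows from two earlier members by modus ponens, or (v) $\phi_i$ is $K(\phi_j)$ for some $j<i$ such that for every $1\le k\le j$, $\phi_k$ is an instance of one of items (ii)-(v). $S_n$ is $\omega$-consistent if there is no formula $\phi$ with a single free variable $y$ such that $S_n\models\exists y\,\neg\phi$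 while $S_n\models\phi(y|\overline m)$ for every $m\in\mathbb{N}$. To define $S'_{n0}$, consider the axioms: (1) universal closures of $K(\phi\rightarrow\psi)\rightarrow (K(\phi)\rightarrow K(\psi))$; (2) universal closures of $K(\phi)\rightarrow K(K(\phi))$; (3) the axioms of Epistemic Arithmetic; (4) $\forall x(K(\phi)\leftrightarrow\langle x,\ulcorner\phi\urcorner\rangle\in W_{\overline n})$ for each $\phi$ whose lone free variable is $x$; (5) universal closures of $K(\phi)$ whenever $\phi$ is valid; (6) $K(\phi)$ whenever $\phi$ is an instance of (1)-(5) or (recursively) (6). Then $S'_{n0}$ is the set of axioms: (I) all instances of (1)-(6) just listed; (II) (Assigned Validity) $\phi^s$, for $\phi$ valid and $s$ an assignment; (III) $K(\phi)$ for each instance $\phi$ of (I), (II) or (recursively) (III). Informal reading given by the paper: $\omega$-consistency of $S_n$ expresses that there is a knowing machine which knows that it has code $n$. *)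

(* Defs.v *)
From HB Require Import structures.
From mathcomp Require Import all_boot.
From Stdlib Require Cantor.

Set Implicit Arguments.
Unset Strict Implicit.
Unset Printing Implicit Defensive.

(** Variables are the natural numbers.  [FNeg], [FImp] and [FAll] are the
    primitive logical constants; the others are classical abbreviations. *)

Inductive term : Type :=
| TVar of nat
| TZero
| TSucc of term
| TAdd of term & term
| TMul of term & term.

Inductive form : Type :=
| FEq of term & term
| FNeg of form
| FImp of form & form
| FAll of nat & form
| FKnow of form.

Definition FAnd (p q : form) : form := FNeg (FImp p (FNeg q)).
Definition FIff (p q : form) : form := FAnd (FImp p q) (FImp q p).
Definition FEx (x : nat) (p : form) : form := FNeg (FAll x (FNeg p)).

Definition num (m : nat) : term := iter m TSucc TZero.

Fixpoint fvt (t : term) : seq nat :=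
  match t with
  | TVar x => [:: x]
  | TZero => [::]
  | TSucc t1 => fvt t1
  | TAdd t1 t2 | TMul t1 t2 => fvt t1 ++ fvt t2
  end.

Fixpoint fv (p : form) : seq nat :=
  match p with
  | FEq t1 t2 => fvt t1 ++ fvt t2
  | FNeg p1 => fv p1
  | FImp p1 p2 => fv p1 ++ fv p2
  | FAll x p1 => [seq y <- fv p1 | y != x]
  | FKnow p1 => fv p1
  end.

Fixpoint know_free (p : form) : bool :=
  match p with
  | FEq _ _ => true
  | FNeg p1 => know_free p1
  | FImp p1 p2 => know_free p1 && know_free p2
  | FAll _ p1 => know_free p1
  | FKnow _ => false
  end.

Definition upd (T : Type) (f : nat -> T) (x : nat) (a : T) : nat -> T :=
  fun y => if y == x then a else f y.

Fixpoint ssubt (f : nat -> term) (t : term) : term :=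
  match t with
  | TVar x => f x
  | TZero => TZero
  | TSucc t1 => TSucc (ssubt f t1)
  | TAdd t1 t2 => TAdd (ssubt f t1) (ssubt f t2)
  | TMul t1 t2 => TMul (ssubt f t1) (ssubt f t2)
  end.

(** Simultaneous replacement of the free variables.  Bound variables are not
    renamed, so capture is possible; see [substitutable]. *)
Fixpoint ssub (f : nat -> term) (p : form) : form :=
  match p with
  | FEq t1 t2 => FEq (ssubt f t1) (ssubt f t2)
  | FNeg p1 => FNeg (ssub f p1)
  | FImp p1 p2 => FImp (ssub f p1) (ssub f p2)
  | FAll x p1 => FAll x (ssub (upd f x (TVar x)) p1)
  | FKnow p1 => FKnow (ssub f p1)
  end.

(** [p(x|t)] *)
Definition subst (x : nat) (t : term) (p : form) : form :=
  ssub (upd TVar x t) p.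

(** [p^s] *)
Definition assigned (s : nat -> nat) (p : form) : form :=
  ssub (fun y => num (s y)) p.

Fixpoint substitutable (x : nat) (t : term) (p : form) : bool :=
  match p with
  | FEq _ _ => true
  | FNeg p1 => substitutable x t p1
  | FImp p1 p2 => substitutable x t p1 && substitutable x t p2
  | FAll y p1 =>
      (x \notin fv (FAll y p1)) || (y \notin fvt t) && substitutable x t p1
  | FKnow p1 => substitutable x t p1
  end.

(** Equality up to renaming of bound variables. *)
Inductive alpha : form -> form -> Prop :=
| alpha_refl p : alpha p p
| alpha_sym p q : alpha p q -> alpha q p
| alpha_trans p q r : alpha p q -> alpha q r -> alpha p r
| alpha_neg p q : alpha p q -> alpha (FNeg p) (FNeg q)
| alpha_imp p p' q q' :
    alpha p p' -> alpha q q' -> alpha (FImp p q) (FImp p' q')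
| alpha_all x p q : alpha p q -> alpha (FAll x p) (FAll x q)
| alpha_know p q : alpha p q -> alpha (FKnow p) (FKnow q)
| alpha_rename x y p :
    y \notin fv (FAll x p) -> substitutable x (TVar y) p ->
    alpha (FAll x p) (FAll y (subst x (TVar y) p)).

(** [q] is obtained from [p] by quantifying universally over its free
    variables, each once, in some order. *)
Definition is_univ_closure (p q : form) : Prop :=
  exists xs : seq nat, [/\ uniq xs, xs =i fv p & q = foldr FAll p xs].

Record fo_structure : Type := FOStructure {
  dom :> Type;
  i_zero : dom;
  i_succ : dom -> dom;
  i_add : dom -> dom -> dom;
  i_mul : dom -> dom -> dom
}.

(** [know p s] is the truth value of [K(p)] under the assignment [s]. *)
Record structure : Type := Structure {
  fo :> fo_structure;
  know : form -> (nat -> fo) -> Prop;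
  know_fv : forall p (s s' : nat -> fo),
    {in fv p, s =1 s'} -> (know p s <-> know p s');
  know_alpha : forall p q (s : nat -> fo),
    alpha p q -> (know p s <-> know q s);
  know_subst : forall p x y (s : nat -> fo),
    substitutable x (TVar y) p ->
    (know (subst x (TVar y) p) s <-> know p (upd s x (s y)))
}.

Fixpoint evalt (M : fo_structure) (s : nat -> M) (t : term) : M :=
  match t with
  | TVar x => s x
  | TZero => i_zero M
  | TSucc t1 => i_succ (evalt s t1)
  | TAdd t1 t2 => i_add (evalt s t1) (evalt s t2)
  | TMul t1 t2 => i_mul (evalt s t1) (evalt s t2)
  end.

Fixpoint sat (M : structure) (s : nat -> M) (p : form) : Prop :=
  match p with
  | FEq t1 t2 => evalt s t1 = evalt s t2
  | FNeg p1 => ~ sat s p1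
  | FImp p1 p2 => sat s p1 -> sat s p2
  | FAll x p1 => forall a : M, sat (upd s x a) p1
  | FKnow p1 => know p1 s
  end.

Definition valid (p : form) : Prop :=
  forall (M : structure) (s : nat -> M), sat s p.

(** [T |= p] *)
Definition entails (T : form -> Prop) (p : form) : Prop :=
  forall M : structure,
    (forall q, T q -> forall s : nat -> M, sat s q) ->
    forall s : nat -> M, sat s p.

Definition std_fo : fo_structure := FOStructure 0 S addn muln.

(** Standard truth of formulas of the language of PA; the choice made for
    [FKnow] is irrelevant for [know_free] formulas. *)
Fixpoint std_sat (s : nat -> std_fo) (p : form) : Prop :=
  match p with
  | FEq t1 t2 => evalt s t1 = evalt s t2
  | FNeg p1 => ~ std_sat s p1
  | FImp p1 p2 => std_sat s p1 -> std_sat s p2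
  | FAll x p1 => forall a : nat, std_sat (upd s x a) p1
  | FKnow _ => False
  end.

(** Terms and formulas are encoded as finite trees, which MathComp numbers
    computably; the Goedel number of [p] is then [pickle p]. *)

Fixpoint tree_of_term (t : term) : GenTree.tree nat :=
  match t with
  | TVar x => GenTree.Leaf x
  | TZero => GenTree.Node 0 [::]
  | TSucc t1 => GenTree.Node 1 [:: tree_of_term t1]
  | TAdd t1 t2 => GenTree.Node 2 [:: tree_of_term t1; tree_of_term t2]
  | TMul t1 t2 => GenTree.Node 3 [:: tree_of_term t1; tree_of_term t2]
  end.

Fixpoint term_of_tree (u : GenTree.tree nat) : option term :=
  match u with
  | GenTree.Leaf x => Some (TVar x)
  | GenTree.Node 0 [::] => Some TZero
  | GenTree.Node 1 [:: u1] => omap TSucc (term_of_tree u1)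
  | GenTree.Node 2 [:: u1; u2] =>
      obind (fun t1 => omap (TAdd t1) (term_of_tree u2)) (term_of_tree u1)
  | GenTree.Node 3 [:: u1; u2] =>
      obind (fun t1 => omap (TMul t1) (term_of_tree u2)) (term_of_tree u1)
  | _ => None
  end.

Lemma tree_of_termK : pcancel tree_of_term term_of_tree.
Proof. by elim=> //= [t ->|t1 -> t2 ->|t1 -> t2 ->]. Qed.

HB.instance Definition _ := Countable.copy term (pcan_type tree_of_termK).

Fixpoint tree_of_form (p : form) : GenTree.tree nat :=
  match p with
  | FEq t1 t2 => GenTree.Node 0 [:: tree_of_term t1; tree_of_term t2]
  | FNeg p1 => GenTree.Node 1 [:: tree_of_form p1]
  | FImp p1 p2 => GenTree.Node 2 [:: tree_of_form p1; tree_of_form p2]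
  | FAll x p1 => GenTree.Node 3 [:: GenTree.Leaf x; tree_of_form p1]
  | FKnow p1 => GenTree.Node 4 [:: tree_of_form p1]
  end.

Fixpoint form_of_tree (u : GenTree.tree nat) : option form :=
  match u with
  | GenTree.Node 0 [:: u1; u2] =>
      obind (fun t1 => omap (FEq t1) (term_of_tree u2)) (term_of_tree u1)
  | GenTree.Node 1 [:: u1] => omap FNeg (form_of_tree u1)
  | GenTree.Node 2 [:: u1; u2] =>
      obind (fun p1 => omap (FImp p1) (form_of_tree u2)) (form_of_tree u1)
  | GenTree.Node 3 [:: GenTree.Leaf x; u1] => omap (FAll x) (form_of_tree u1)
  | GenTree.Node 4 [:: u1] => omap FKnow (form_of_tree u1)
  | _ => None
  end.

Lemma tree_of_formK : pcancel tree_of_form form_of_tree.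
Proof.
by elim=> /= [t1 t2|p ->|p -> q ->|x p ->|p ->] //; rewrite !tree_of_termK.
Qed.

HB.instance Definition _ := Countable.copy form (pcan_type tree_of_formK).

Definition gn (p : form) : nat := pickle p.

Definition pair_code (m k : nat) : nat := Cantor.to_nat (m, k).

(** Programs for the unary partial recursive functions: the initial functions
    (zero, successor, the two inverses of the pairing function), pairing,
    composition, primitive recursion and unbounded search. *)
Inductive prog : Type :=
| PZero
| PSucc
| PFst
| PSnd
| PPair of prog & prog
| PComp of prog & prog
| PRec of prog & prog
| PMin of prog.

(** [runs c a v]: the function computed by [c] is defined at [a], with
    value [v]. *)
Inductive runs : prog -> nat -> nat -> Prop :=
| runs_zero a : runs PZero a 0
| runs_succ a : runs PSucc a a.+1
| runs_fst a b : runs PFst (pair_code a b) a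
| runs_snd a b : runs PSnd (pair_code a b) b
| runs_pair f g a u v :
    runs f a u -> runs g a v -> runs (PPair f g) a (pair_code u v)
| runs_comp f g a u v :
    runs g a u -> runs f u v -> runs (PComp f g) a v
| runs_rec0 f g a v :
    runs f a v -> runs (PRec f g) (pair_code a 0) v
| runs_recS f g a k u v :
    runs (PRec f g) (pair_code a k) u ->
    runs g (pair_code a (pair_code k u)) v ->
    runs (PRec f g) (pair_code a k.+1) v
| runs_min f a k (u : nat -> nat) :
    runs f (pair_code a k) 0 ->
    (forall i, i < k -> runs f (pair_code a i) (u i).+1) ->
    runs (PMin f) a k.

Fixpoint tree_of_prog (c : prog) : GenTree.tree nat :=
  match c with
  | PZero => GenTree.Node 0 [::]
  | PSucc => GenTree.Node 1 [::]
  | PFst => GenTree.Node 2 [::]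
  | PSnd => GenTree.Node 3 [::]
  | PPair f g => GenTree.Node 4 [:: tree_of_prog f; tree_of_prog g]
  | PComp f g => GenTree.Node 5 [:: tree_of_prog f; tree_of_prog g]
  | PRec f g => GenTree.Node 6 [:: tree_of_prog f; tree_of_prog g]
  | PMin f => GenTree.Node 7 [:: tree_of_prog f]
  end.

Fixpoint prog_of_tree (u : GenTree.tree nat) : option prog :=
  match u with
  | GenTree.Node 0 [::] => Some PZero
  | GenTree.Node 1 [::] => Some PSucc
  | GenTree.Node 2 [::] => Some PFst
  | GenTree.Node 3 [::] => Some PSnd
  | GenTree.Node 4 [:: u1; u2] =>
      obind (fun f => omap (PPair f) (prog_of_tree u2)) (prog_of_tree u1)
  | GenTree.Node 5 [:: u1; u2] =>
      obind (fun f => omap (PComp f) (prog_of_tree u2)) (prog_of_tree u1)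
  | GenTree.Node 6 [:: u1; u2] =>
      obind (fun f => omap (PRec f) (prog_of_tree u2)) (prog_of_tree u1)
  | GenTree.Node 7 [:: u1] => omap PMin (prog_of_tree u1)
  | _ => None
  end.

Lemma tree_of_progK : pcancel tree_of_prog prog_of_tree.
Proof. by elim=> //= [f -> g ->|f -> g ->|f -> g ->|f ->]. Qed.

HB.instance Definition _ := Countable.copy prog (pcan_type tree_of_progK).

(** [W e] is the domain of the function computed by the program numbered [e],
    and is empty if [e] numbers no program. *)
Definition W (e z : nat) : Prop :=
  exists c : prog, unpickle e = Some c /\ exists v, runs c z v.

(** [inW n p] plays the role of the formula abbreviated
    "<x, gn(p)> is in W_n": a formula of the language of PA with free variable
    [x] which says so in the standard model.  No particular
    arithmetization is singled out. *)
Definition expresses_membership (x : nat) (inW : nat -> form -> form) : Prop :=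
  forall (n : nat) (p : form),
    [/\ know_free (inW n p),
        fv (inW n p) =i [:: x] &
        forall s : nat -> nat,
          std_sat s (inW n p) <-> W n (pair_code (s x) (gn p))].

Inductive PA_basic : form -> Prop :=
| PA_succ_neq0 : PA_basic (FNeg (FEq (TSucc (TVar 0)) TZero))
| PA_succ_inj :
    PA_basic (FImp (FEq (TSucc (TVar 0)) (TSucc (TVar 1)))
                   (FEq (TVar 0) (TVar 1)))
| PA_add0 : PA_basic (FEq (TAdd (TVar 0) TZero) (TVar 0))
| PA_addS :
    PA_basic (FEq (TAdd (TVar 0) (TSucc (TVar 1)))
                  (TSucc (TAdd (TVar 0) (TVar 1))))
| PA_mul0 : PA_basic (FEq (TMul (TVar 0) TZero) TZero)
| PA_mulS :
    PA_basic (FEq (TMul (TVar 0) (TSucc (TVar 1)))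
                  (TAdd (TMul (TVar 0) (TVar 1)) (TVar 0))).

(** [TSucc (TVar x)] is always substitutable for [x]. *)
Definition induction (x : nat) (p : form) : form :=
  FImp (subst x TZero p)
    (FImp (FAll x (FImp p (subst x (TSucc (TVar x)) p))) (FAll x p)).

Inductive EA_axiom : form -> Prop :=
| EA_basic p q : PA_basic p -> is_univ_closure p q -> EA_axiom q
| EA_induction x p q : is_univ_closure (induction x p) q -> EA_axiom q.

Definition K_distr (p q : form) : form :=
  FImp (FKnow (FImp p q)) (FImp (FKnow p) (FKnow q)).

Definition K_truth (p : form) : form := FImp (FKnow p) p.

Definition K_K (p : form) : form := FImp (FKnow p) (FKnow (FKnow p)).

Definition having_code (x : nat) (inW : nat -> form -> form) (n : nat)
    (p : form) : form :=
  FAll x (FIff (FKnow p) (inW n p)).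

Section SystemS.

Variables (x : nat) (inW : nat -> form -> form) (n : nat).

Inductive S_local : form -> Prop :=
| S_truth p q : is_univ_closure (K_truth p) q -> S_local q.

Inductive S_global : form -> Prop :=
| S_distr p q r : is_univ_closure (K_distr p q) r -> S_global r
| S_KK p q : is_univ_closure (K_K p) q -> S_global q
| S_EA p : EA_axiom p -> S_global p
| S_code p : fv p =i [:: x] -> S_global (having_code x inW n p).

(** The [i]-th member of the sequence [l]; members are counted from 0, and the
    default value is never reached in a derivation. *)
Definition line (l : seq form) (i : nat) : form := nth (FEq TZero TZero) l i.

(** Justification of a line without recourse to local axioms, i.e. by a global
    axiom, validity, modus ponens or global necessitation. *)
Inductive S_line_global (l : seq form) : nat -> Prop :=
| line_axiom i : S_global (line l i) -> S_line_global l i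
| line_valid i : valid (line l i) -> S_line_global l i
| line_mp i j k : j < i -> k < i ->
    line l k = FImp (line l j) (line l i) -> S_line_global l i
| line_nec i j : j < i -> line l i = FKnow (line l j) ->
    (forall k, k <= j -> S_line_global l k) -> S_line_global l i.

Definition S_derivation (l : seq form) : Prop :=
  forall i, i < size l -> S_local (line l i) \/ S_line_global l i.

(** [S_n |= p] *)
Definition S_proves (p : form) : Prop :=
  exists l : seq form, S_derivation (rcons l p).

Definition S_omega_consistent : Prop :=
  ~ exists (p : form) (y : nat),
      [/\ fv p =i [:: y],
          S_proves (FEx y (FNeg p)) &
          forall m : nat, S_proves (subst y (num m) p)].

Inductive S'0_base : form -> Prop :=
| S'0_distr p q r : is_univ_closure (K_distr p q) r -> S'0_base r
| S'0_KK p q : is_univ_closure (K_K p) q -> S'0_base q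
| S'0_EA p : EA_axiom p -> S'0_base p
| S'0_code p : fv p =i [:: x] -> S'0_base (having_code x inW n p)
| S'0_valid p q : valid p -> is_univ_closure (FKnow p) q -> S'0_base q
| S'0_know p : S'0_base p -> S'0_base (FKnow p).

Inductive S'0 : form -> Prop :=
| S'0_I p : S'0_base p -> S'0 p
| S'0_assigned_validity p (s : nat -> nat) : valid p -> S'0 (assigned s p)
| S'0_III p : S'0 p -> S'0 (FKnow p).

End SystemS.

(* Main.v *)
Require Import Defs.
From mathcomp Require Import all_boot.
From Stdlib Require Cantor.
From mathcomp Require Import boolp classical_sets.
From mathcomp Require filter.

Set Implicit Arguments.
Unset Strict Implicit.
Unset Printing Implicit Defensive.

(** It suffices to find one structure [N] over the standard natural numbers
    in which every theorem of [S_n] is true: if [S_n] proves each numerical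
    instance [p(y|m)], then [p] is true in [N] at every natural number, so
    [N] refutes [exists y, ~ p].  (Numerical instances have the expected truth
    value in [N] by [sat_knower_subst_num].)

    Let [T] be the theory [S'_n0].  In [N] ([knower T]), [K(p)] is true under
    [s] when [T] entails the sentence [p^s].  The hypothesis on [n] says that
    [W_n] is the set enumerating exactly this knowledge, so [N] satisfies the
    schema by which the machine knows its code ([knower_having_code]).  The
    other axioms of [T] hold in [N] for direct reasons ([knower_S'0]), except
    one: [K(p) -> K(K(p))] demands that [T] entail [K(p)] whenever it entails
    [p].  Entailment is semantic, so this is where compactness comes in: if
    [T] entails [p], then an implication [q1 -> ... -> qk -> p] with all the
    [qi] in [T] is valid.  Now [T] contains [K] of valid formulas, [K] of its
    own members, and distribution of [K] over implications, which together
    yield [K(p)] ([S'0_necessitation]).  Compactness for the base logic is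
    proved with an ultraproduct ([compactness]).

    Since [N] satisfies [T], what is known in [N] is true in [N]
    ([knower_known]), which gives the local axioms [K(p) -> p].  The theory
    [T] entails all assigned instances of any line of an [S_n]-derivation
    obtained without local axioms ([entails_S_line_global]); global
    necessitation applies only to such lines, which are therefore known and
    not merely true in [N].  So all theorems of [S_n] are true in [N]
    ([knower_S_proves]). *)

(** * Simultaneous substitution *)

Lemma eq_ssubt f g t : {in fvt t, f =1 g} -> ssubt f t = ssubt g t.
Proof.
elim: t => //= [x|t IH|t IHt u IHu|t IHt u IHu] H.
- by rewrite H // inE.
- by rewrite IH.
- by rewrite IHt ?IHu // => y Hy; apply: H; rewrite mem_cat Hy ?orbT.
- by rewrite IHt ?IHu // => y Hy; apply: H; rewrite mem_cat Hy ?orbT.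
Qed.

Lemma eq_in_upd (T : Type) (f g : nat -> T) (x : nat) (a : T) p :
  {in fv (FAll x p), f =1 g} -> {in fv p, upd f x a =1 upd g x a}.
Proof.
move=> H y Hy; rewrite /upd; case: eqP => // /eqP ne.
by apply: H; rewrite /= mem_filter ne.
Qed.

Lemma eq_in_cat (T : Type) (f g : nat -> T) (s1 s2 : seq nat) :
  {in s1 ++ s2, f =1 g} -> {in s1, f =1 g} /\ {in s2, f =1 g}.
Proof. by move=> H; split=> y Hy; apply: H; rewrite mem_cat Hy ?orbT. Qed.

Lemma eq_ssub f g p : {in fv p, f =1 g} -> ssub f p = ssub g p.
Proof.
elim: p f g => /= [t u|p IH|p IHp q IHq|x p IH|p IH] f g H.
- by have [Ht Hu] := eq_in_cat H; rewrite (eq_ssubt Ht) (eq_ssubt Hu).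
- by rewrite (IH f g).
- by have [Hp Hq] := eq_in_cat H; rewrite (IHp f g) // (IHq f g).
- by rewrite (IH _ (upd g x (TVar x))) //; apply: eq_in_upd.
- by rewrite (IH f g).
Qed.

Lemma upd_id (T : Type) (f : nat -> T) x : upd f x (f x) =1 f.
Proof. by move=> y; rewrite /upd; case: eqP => [->|]. Qed.

Lemma ssubt_TVar t : ssubt TVar t = t.
Proof. by elim: t => //= [t ->|t -> u ->|t -> u ->]. Qed.

Lemma ssub_TVar p : ssub TVar p = p.
Proof.
elim: p => /= [t u|p ->|p -> q ->|x p IH|p ->] //; first by rewrite !ssubt_TVar.
by rewrite (eq_ssub (in1W (upd_id _ _))) IH.
Qed.

Lemma ssub_closed f p : fv p = [::] -> ssub f p = p.
Proof.
by move=> H; rewrite -[RHS]ssub_TVar; apply: eq_ssub => y; rewrite H.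
Qed.

Lemma subst_fresh x t p : x \notin fv p -> subst x t p = p.
Proof.
move=> H; rewrite -[RHS]ssub_TVar; apply: eq_ssub => y Hy.
by rewrite /upd; case: eqP => // E; rewrite -E Hy in H.
Qed.

(** No variable of [f y] is captured when [f y] replaces a free [y]; this is
    [substitutable], for simultaneous substitutions. *)
Fixpoint free_for (f : nat -> term) (p : form) : bool :=
  match p with
  | FEq _ _ => true
  | FNeg p1 | FKnow p1 => free_for f p1
  | FImp p1 p2 => free_for f p1 && free_for f p2
  | FAll x p1 =>
      all (fun y => (y == x) || (x \notin fvt (f y))) (fv p1)
      && free_for (upd f x (TVar x)) p1
  end.

Lemma eq_free_for f g p : {in fv p, f =1 g} -> free_for f p = free_for g p.
Proof.
elim: p f g => //= [p IHp q IHq|x p IH] f g H.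
  by have [Hp Hq] := eq_in_cat H; rewrite (IHp f g) // (IHq f g).
congr (_ && _); last by apply: IH; apply: eq_in_upd.
apply: eq_in_all => y Hy; case: eqP => //= /eqP ne.
by rewrite H // mem_filter ne.
Qed.

Lemma ssubt_comp f g t :
  ssubt g (ssubt f t) = ssubt (fun y => ssubt g (f y)) t.
Proof. by elim: t => //= [t ->|t -> u ->|t -> u ->]. Qed.

Lemma ssub_comp f g p :
  free_for f p -> ssub g (ssub f p) = ssub (fun y => ssubt g (f y)) p.
Proof.
elim: p f g => /= [t u|p IH|p IHp q IHq|x p IH|p IH] f g.
- by rewrite !ssubt_comp.
- by move=> H; rewrite IH.
- by case/andP=> Hp Hq; rewrite IHp ?IHq.
- case/andP=> /allP Hx Hp; rewrite IH //; congr FAll.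
  apply: eq_ssub => y Hy; rewrite /upd; case: eqP => /= [_|/eqP ne].
    by rewrite eqxx.
  apply: eq_ssubt => z Hz; case: eqP => // Ezx.
  by have := Hx y Hy; rewrite (negbTE ne) -Ezx Hz.
- by move=> H; rewrite IH.
Qed.

(** Under this condition capture is impossible in every formula, and the
    condition persists below quantifiers.  It covers the substitutions of
    numerals and of [TSucc (TVar x)] for [x]. *)
Definition tame (f : nat -> term) : Prop :=
  forall y, {subset fvt (f y) <= [:: y]}.

Lemma tame_TVar : tame TVar.
Proof. by move=> y z. Qed.

Lemma tame_upd f x : tame f -> tame (upd f x (TVar x)).
Proof. by move=> Hf y z; rewrite /upd; case: eqP => [->|_]; [|apply: Hf]. Qed.

Lemma fvt_num m : fvt (num m) = [::].
Proof. by elim: m. Qed.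

Lemma tame_num (s : nat -> nat) : tame (fun y => num (s y)).
Proof. by move=> y z; rewrite fvt_num. Qed.

Lemma tame_free_for f p : tame f -> free_for f p.
Proof.
elim: p f => //= [p IHp q IHq|x p IH] f Hf; first by rewrite IHp ?IHq.
rewrite IH ?andbT; last exact: tame_upd.
apply/allP=> y Hy; case: eqP => //= /eqP ne; apply/negP=> /Hf.
by rewrite inE eq_sym (negbTE ne).
Qed.

Lemma substitutable_free_for x t p :
  substitutable x t p -> free_for (upd TVar x t) p.
Proof.
elim: p => //= [p IHp q IHq|z p IH].
  by case/andP=> Hp Hq; rewrite IHp ?IHq.
case: (boolP (x \in [seq y <- fv p | y != z])) => [|xp _]; last first.
  rewrite -/(free_for (upd TVar x t) (FAll z p)).
  rewrite (@eq_free_for _ TVar); first exact: tame_free_for tame_TVar.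
  by move=> y Hy; rewrite /upd; case: eqP => // E; rewrite -E Hy in xp.
rewrite mem_filter => /andP[nxz xp] /= /andP[zt Hs].
apply/andP; split.
  apply/allP=> y Hy; case: eqP => //= /eqP ne.
  by rewrite /upd; case: eqP => //= _; rewrite inE eq_sym.
rewrite -(@eq_free_for (upd TVar x t)) ?IH // => y Hy.
rewrite /upd; case: (y =P z) => // ->.
by case: eqP => // E; rewrite E eqxx in nxz.
Qed.

Lemma fvt_ssubt_tame f t y :
  tame f -> y \in fvt (ssubt f t) -> (y \in fvt t) && (y \in fvt (f y)).
Proof.
move=> Hf; elim: t => //= [z Hz|t IHt u IHu|t IHt u IHu].
- by have := Hf z _ Hz; move: Hz; rewrite !inE => + /eqP E; rewrite E eqxx.
- by rewrite !mem_cat => /orP[/IHt|/IHu] /andP[-> ->]; rewrite ?orbT.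
- by rewrite !mem_cat => /orP[/IHt|/IHu] /andP[-> ->]; rewrite ?orbT.
Qed.

Lemma fv_ssub_tame f p y :
  tame f -> y \in fv (ssub f p) -> (y \in fv p) && (y \in fvt (f y)).
Proof.
elim: p f => //= [t u|p IHp q IHq|x p IH] f Hf.
- by rewrite !mem_cat => /orP[] /(fvt_ssubt_tame Hf) /andP[-> ->];
    rewrite ?orbT.
- by rewrite !mem_cat => /orP[/(IHp _ Hf)|/(IHq _ Hf)] /andP[-> ->];
    rewrite ?orbT.
- rewrite !mem_filter => /andP[ne /(IH _ (tame_upd Hf)) /andP[-> ]].
  by rewrite /upd (negbTE ne).
Qed.

Lemma substitutable_ssub f x t p :
  tame f -> substitutable x t p -> substitutable x t (ssub f p).
Proof.
elim: p f => //= [p IHp q IHq|z p IH] f Hf.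
- by case/andP=> Hp Hq; rewrite IHp ?IHq.
- case/orP=> [Hx|/andP[-> Hs]]; apply/orP.
    left; apply: contra Hx.
    by case/(@fv_ssub_tame f (FAll z p) x Hf)/andP.
  by right; apply: IH => //; apply: tame_upd.
Qed.

(** Replacing free variables by numerals respects renaming of bound variables.
    Stating this for [tame] substitutions rather than for numerals lets the
    induction pass below quantifiers. *)
Lemma alpha_ssub f p q : tame f -> alpha p q -> alpha (ssub f p) (ssub f q).
Proof.
move=> Hf H; elim: H f Hf => {p q}.
- by move=> p f _; apply: alpha_refl.
- by move=> p q _ IH f Hf; apply/alpha_sym/IH.
- by move=> p q r _ IH1 _ IH2 f Hf; apply: alpha_trans (IH1 f Hf) (IH2 f Hf).
- by move=> p q _ IH f Hf; apply/alpha_neg/IH.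
- move=> p p' q q' _ IH1 _ IH2 f Hf.
  by apply: alpha_imp; [apply: IH1|apply: IH2].
- by move=> x p q _ IH f Hf; apply/alpha_all/IH/tame_upd.
- by move=> p q _ IH f Hf; apply/alpha_know/IH.
move=> x y p Hy Hs f Hf /=.
have Hg : tame (upd f x (TVar x)) by apply: tame_upd.
(* Renaming [x] to [y] and applying [f] commute, so that the two sides are
   again related by a single renaming. *)
have -> : ssub (upd f y (TVar y)) (subst x (TVar y) p)
          = subst x (TVar y) (ssub (upd f x (TVar x)) p).
  rewrite /subst !ssub_comp ?substitutable_free_for ?tame_free_for //.
  apply: eq_ssub => z Hz; rewrite /upd; case: (z =P x) => [_|/eqP nzx] /=.
    by rewrite !eqxx.
  case: (z =P y) => [Ezy|_].
    by move: Hy; rewrite /= mem_filter -Ezy nzx Hz.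
  rewrite -[LHS]ssubt_TVar; apply: eq_ssubt => w /Hf.
  by rewrite inE => /eqP->; rewrite (negbTE nzx).
apply: alpha_rename; last exact: substitutable_ssub.
apply: contra Hy; rewrite /= !mem_filter => /andP[-> /=].
by case/(fv_ssub_tame Hg)/andP.
Qed.

(** * Truth in a structure *)

Lemma eq_evalt (M : fo_structure) (s s' : nat -> M) t :
  {in fvt t, s =1 s'} -> evalt s t = evalt s' t.
Proof.
elim: t => //= [x|t IH|t IHt u IHu|t IHt u IHu] H.
- by rewrite H // inE.
- by rewrite IH.
- by have [Ht Hu] := eq_in_cat H; rewrite IHt ?IHu.
- by have [Ht Hu] := eq_in_cat H; rewrite IHt ?IHu.
Qed.

Lemma eq_sat (M : structure) (s s' : nat -> M) p :
  {in fv p, s =1 s'} -> sat s p <-> sat s' p.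
Proof.
elim: p s s' => /= [t u|p IH|p IHp q IHq|x p IH|p IH] s s' H.
- by have [Ht Hu] := eq_in_cat H; rewrite (eq_evalt Ht) (eq_evalt Hu).
- by rewrite (IH s s').
- by have [Hp Hq] := eq_in_cat H; rewrite (IHp s s') ?(IHq s s').
- by split=> Ha a; move: (Ha a); apply IH; apply: eq_in_upd => y Hy; rewrite H.
- exact: know_fv.
Qed.

Lemma sat_closed (M : structure) (s s' : nat -> M) p :
  fv p = [::] -> sat s p -> sat s' p.
Proof. by move=> H; apply eq_sat => y; rewrite H. Qed.

(** In a general structure only the replacement of a variable by a variable can
    be read as a change of assignment: nothing relates [K(p(x|t))] to [K(p)]
    for other terms [t]. *)
Lemma sat_subst_var (M : structure) (s : nat -> M) p x y :
  substitutable x (TVar y) p ->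
  sat s (subst x (TVar y) p) <-> sat (upd s x (s y)) p.
Proof.
elim: p s => [t u|p IH|p IHp q IHq|z p IH|p IH] s.
- have E w : evalt s (ssubt (upd TVar x (TVar y)) w) = evalt (upd s x (s y)) w.
    elim: w => //= [w|w ->|w -> w' ->|w -> w' ->] //.
    by rewrite /upd; case: eqP.
  by rewrite /subst /= !E.
- by move=> H; move: (IH s H); rewrite /subst /= => ->.
- rewrite /=; case/andP=> /(IHp s) + /(IHq s).
  by rewrite /subst /= => -> ->.
- case: (boolP (x \in fv (FAll z p))) => [Hx|Hx _]; last first.
    rewrite subst_fresh //; apply: eq_sat => w Hw.
    by rewrite /upd; case: eqP => // E; rewrite -E Hw in Hx.
  rewrite [substitutable _ _ _]/= -/(fv (FAll z p)) Hx /= inE.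
  move: Hx; rewrite /= mem_filter => /andP[nxz xp] /andP[nzy Hs].
  have -> : ssub (upd (upd TVar x (TVar y)) z (TVar z)) p
            = subst x (TVar y) p.
    apply: eq_ssub => w _; rewrite /upd; case: (w =P z) => // ->.
    by rewrite eq_sym (negbTE nxz).
  have E a : sat (upd s z a) (subst x (TVar y) p)
             <-> sat (upd (upd s x (s y)) z a) p.
    rewrite IH //; apply: eq_sat => w _; rewrite /upd.
    rewrite [y == z]eq_sym (negbTE nzy).
    by case: (w =P x) => // ->; rewrite (negbTE nxz).
  by split=> Ha a; apply/E.
- exact: (@know_subst M p x y s).
Qed.

Lemma sat_alpha (M : structure) p q :
  alpha p q -> forall s : nat -> M, sat s p <-> sat s q.
Proof.
elim=> {p q}.
- by [].
- by move=> p q _ IH s; rewrite IH.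
- by move=> p q r _ IH1 _ IH2 s; rewrite IH1.
- by move=> p q _ IH s /=; rewrite IH.
- by move=> p p' q q' _ IH1 _ IH2 s /=; rewrite IH1 IH2.
- by move=> x p q _ IH s /=; split=> H a; apply/IH.
- by move=> p q H _ s; apply: know_alpha.
move=> x y p Hy Hs s /=.
have E a : sat (upd s y a) (subst x (TVar y) p) <-> sat (upd s x a) p.
  rewrite sat_subst_var //; apply: eq_sat => z Hz; rewrite /upd eqxx.
  case: eqP => // /eqP nzx; case: eqP => // Ezy.
  by move: Hy; rewrite /= mem_filter -Ezy nzx Hz.
by split=> H a; apply/E.
Qed.

Lemma sat_closure (M : structure) p q :
  is_univ_closure p q -> (forall s : nat -> M, sat s p) ->
  forall s : nat -> M, sat s q.
Proof.
case=> xs [_ _ ->] H; elim: xs => //= x xs IH s a; exact: IH.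
Qed.

Lemma fv_closure p q : is_univ_closure p q -> fv q = [::].
Proof.
case=> xs [_ Hxs ->].
have E ys : fv (foldr FAll p ys) =i [pred z in fv p | z \notin ys].
  elim: ys => [z|y ys IH z]; first by rewrite !inE andbT.
  by rewrite /= mem_filter IH !inE negb_or andbCA.
case F: (fv _) => [//|z zs]; have := E xs z.
by rewrite F !inE eqxx Hxs andbN.
Qed.

Lemma closure_closed p : fv p = [::] -> is_univ_closure p p.
Proof. by move=> E; exists [::]; rewrite E. Qed.

Lemma fv_imps ps p :
  (forall q, q \in ps -> fv q = [::]) -> fv p = [::] ->
  fv (foldr FImp p ps) = [::].
Proof.
move=> Hps fvp; elim: ps Hps => //= q ps IH H.
by rewrite (H q) ?inE ?eqxx // IH // => r Hr; apply: H; rewrite inE Hr orbT.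
Qed.

Lemma sat_imps (M : structure) (s : nat -> M) ps p :
  sat s (foldr FImp p ps) <->
  ((forall q, q \in ps -> sat s q) -> sat s p).
Proof.
elim: ps => [|r ps IH] /=; first by split=> [h _|h]; [|apply: h].
split=> [H Hps|H Hr].
  apply: (proj1 IH) => [|q Hq]; last by apply: Hps; rewrite inE Hq orbT.
  by apply: H; apply: Hps; rewrite inE eqxx.
by apply/IH=> Hps; apply: H => q; rewrite inE => /predU1P[->|/Hps].
Qed.

(** * Ultraproducts and compactness *)

(** The three conditions imposed on the truth values of [K(p)] are
    equivalences that hold in each factor, so they pass to the ultraproduct
    without any further argument. *)
Section Ultraproduct.

Variables (U : set_system nat) (HU : filter.UltraFilter U).
Variable M : nat -> structure.

Let U_filter : filter.Filter U :=
  @filter.filter_filter _ _ (@filter.ultra_proper _ _ HU).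

Let US (A B : nat -> Prop) : (forall k, A k -> B k) -> U A -> U B.
Proof. by move=> H; apply: filter.filterS. Qed.

Let UI (A B : nat -> Prop) : U A -> U B -> U (fun k => A k /\ B k).
Proof. exact: filter.filterI. Qed.

Let UT (A : nat -> Prop) : (forall k, A k) -> U A.
Proof. by move=> H; apply: (US _ filter.filterT) => k _; apply: H. Qed.

Let UN (A : nat -> Prop) : U (fun k => ~ A k) <-> ~ U A.
Proof.
split=> [H1 H2|H].
  have := UI H1 H2; rewrite (_ : (fun k => _) = set0).
    exact: (@filter.filter_not_empty _ _ (@filter.ultra_proper _ _ HU)).
  by apply: funext => k; apply: propext; split=> // -[].
by case: (@filter.in_ultra_setVsetC _ _ A HU).
Qed.

Let seqs : Type := forall k, M k.

Let same (f g : seqs) : Prop := U (fun k => f k = g k).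

Let same_refl f : same f f.
Proof. exact: UT. Qed.

Let same_sym f g : same f g -> same g f.
Proof. exact: US. Qed.

Let same_trans f g h : same f g -> same g h -> same f h.
Proof. by move=> H1 H2; apply: US (UI H1 H2) => k [-> ->]. Qed.

(* Equality is interpreted as equality in the domain, so the domain must be a
   true quotient: each class is represented by a chosen member. *)
Let repr (f : seqs) : seqs :=
  @xget {classic seqs} (fun k => i_zero (M k)) (same f).

Let reprP f : same f (repr f).
Proof.
exact: (@xgetPex {classic seqs} _ (same f) (ex_intro _ f (same_refl f))).
Qed.

Let same_repr f g : same f g -> repr f = repr g.
Proof.
move=> H; rewrite /repr (_ : same f = same g) //.
apply: funext => h; apply: propext; split; apply: same_trans => //.
exact: same_sym.
Qed.

Let Q : Type := {f : seqs | repr f = f}.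

Let pi (f : seqs) : Q := exist _ (repr f) (esym (same_repr (reprP f))).

Let pi_same f : same (sval (pi f)) f.
Proof. exact/same_sym/reprP. Qed.

Let Q_eq (a b : Q) : a = b <-> same (sval a) (sval b).
Proof.
split=> [->//|]; case: a b => [f Hf] [g Hg] /= H.
by apply: eq_exist; rewrite -Hf -Hg; apply: same_repr.
Qed.

Let ultra_fo : fo_structure := @FOStructure Q
  (pi (fun k => i_zero (M k)))
  (fun a => pi (fun k => i_succ (sval a k)))
  (fun a b => pi (fun k => i_add (sval a k) (sval b k)))
  (fun a b => pi (fun k => i_mul (sval a k) (sval b k))).

Let component (s : nat -> Q) (k : nat) : nat -> M k := fun y => sval (s y) k.

Let component_upd s x a k :
  component (upd s x a) k = upd (component s k) x (sval a k).
Proof. by apply: funext => y; rewrite /component /upd; case: eqP. Qed.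

Let ultra_know p (s : nat -> ultra_fo) : Prop :=
  U (fun k => know p (component s k)).

Let UE (A B : nat -> Prop) : (forall k, A k <-> B k) -> U A <-> U B.
Proof. by move=> H; split; apply: US => k /H. Qed.

Let ultra_know_fv p (s s' : nat -> ultra_fo) :
  {in fv p, s =1 s'} -> ultra_know p s <-> ultra_know p s'.
Proof.
by move=> H; apply: UE => k; apply: know_fv => y Hy; rewrite /component H.
Qed.

Let ultra_know_alpha p q (s : nat -> ultra_fo) :
  alpha p q -> ultra_know p s <-> ultra_know q s.
Proof. by move=> H; apply: UE => k; apply: know_alpha. Qed.

Let ultra_know_subst p x y (s : nat -> ultra_fo) :
  substitutable x (TVar y) p ->
  ultra_know (subst x (TVar y) p) s <-> ultra_know p (upd s x (s y)).
Proof.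
by move=> H; apply: UE => k; rewrite (@component_upd s) (know_subst _ H).
Qed.

Definition ultraproduct : structure :=
  Structure ultra_know_fv ultra_know_alpha ultra_know_subst.

Let los_term t (s : nat -> ultra_fo) :
  same (sval (evalt s t)) (fun k => evalt (component s k) t).
Proof.
elim: t => [x||t IH|t IHt u IHu|t IHt u IHu] /=.
- exact: same_refl.
- exact: pi_same.
- by apply: same_trans (pi_same _) _; apply: US IH => k ->.
- by apply: same_trans (pi_same _) _; apply: US (UI IHt IHu) => k [-> ->].
- by apply: same_trans (pi_same _) _; apply: US (UI IHt IHu) => k [-> ->].
Qed.

(** The theorem of Los. *)
Let los p (s : nat -> ultraproduct) :
  sat s p <-> U (fun k => sat (component s k) p).
Proof.
elim: p s => [t u|p IH|p IHp q IHq|x p IH|p IH] s /=.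
- rewrite Q_eq; split=> H.
    apply: US (UI (UI (los_term t s) (los_term u s)) H) => k [[<- <-]] //.
  apply: same_trans (los_term t s) _.
  exact: same_trans H (same_sym (los_term u s)).
- by rewrite IH UN.
- rewrite IHp IHq; split=> [H|H1 H2]; last first.
    by apply: US (UI H1 H2) => k [h] /h.
  apply: contrapT => /UN Hn.
  have /UN : U (fun k => ~ sat (component s k) q).
    by apply: US Hn => k h hq; apply: h.
  apply; apply: H; apply: US Hn => k h.
  by apply: contrapT => h'; apply: h => /h'.
- split=> [H|H a]; last first.
    by apply/IH; apply: US H => k h; rewrite component_upd.
  (* In each factor [b k] is a counterexample to [FAll x p] if there is one;
     testing the single class [pi b] then decides almost all factors. *)
  have Hex k : exists b : M k,
      sat (upd (component s k) x b) p ->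
      forall b', sat (upd (component s k) x b') p.
    have [[b Hb]|Hb] :=
      pselect (exists b : M k, ~ sat (upd (component s k) x b) p).
      by exists b.
    exists (i_zero (M k)) => _ b'; apply: contrapT => h.
    by apply: Hb; exists b'.
  pose b k := projT1 (cid (Hex k)).
  have Hb k : sat (upd (component s k) x (b k)) p ->
      forall b', sat (upd (component s k) x b') p.
    by rewrite /b; case: cid.
  have /IH := H (pi b).
  apply: (fun h1 h2 => US h1 (UI (pi_same b) h2)) => k [E].
  by rewrite component_upd E => /Hb.
- by [].
Qed.

(** The assignment [s' y] is the class of [fun k => s k y], whose chosen
    representative agrees with it on a large set of indices that depends on
    [y].  As a formula has finitely many free variables, finitely many such
    sets are intersected. *)
Lemma ultraproduct_sat (s : forall k, nat -> M k) :
  exists s' : nat -> ultraproduct,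
    forall p, sat s' p <-> U (fun k => sat (s k) p).
Proof.
pose s' y : ultraproduct := pi (fun k => s k y).
exists s' => p; rewrite los.
have [m Hm] : exists m, forall y, y \in fv p -> y < m.
  exists (\max_(y <- fv p) y).+1 => y Hy.
  by rewrite ltnS (@leq_bigmax_seq _ (fv p) xpredT id).
have : U (fun k => forall y, y < m -> component s' k y = s k y).
  elim: m {Hm} => [|m IH]; first exact: UT.
  apply: US (UI IH (pi_same (fun k => s k m))) => k [h1 h2] y.
  by rewrite ltnS leq_eqVlt => /predU1P[->|/h1].
move=> Hs; split=> H; apply: US (UI Hs H) => k [E].
- by apply eq_sat => y /Hm /E.
- by apply eq_sat => y /Hm /E.
Qed.

End Ultraproduct.

(** If no finite part of [T] implies [p], there are, for each [k], a structure
    and an assignment satisfying the members of [T] with code below [k] but not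
    [p].  An ultraproduct over a nonprincipal ultrafilter on the indices [k]
    satisfies all of [T] and not [p].  Members of [T] are sentences, so their
    truth under one assignment is their truth in the structure. *)
Lemma compactness (T : form -> Prop) p :
  (forall q, T q -> fv q = [::]) -> entails T p ->
  exists2 ps : seq form, (forall q, q \in ps -> T q) & valid (foldr FImp p ps).
Proof.
move=> HT Hp; apply: contrapT => Hno.
have Hc k : exists Ms : {M : structure & nat -> M},
    (forall q, T q -> pickle q < k -> sat (projT2 Ms) q) /\
    ~ sat (projT2 Ms) p.
  pose ps := [seq q <- pmap unpickle (iota 0 k) | `[< T q >]].
  have psT q : q \in ps -> T q by rewrite mem_filter => /andP[/asboolP].
  apply: contrapT => Hk; apply: Hno; exists ps => // M s.
  apply/sat_imps => Hs; apply: contrapT => Hsp; apply: Hk.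
  exists (existT _ M s); split=> // q Tq Hq; apply: Hs.
  rewrite mem_filter mem_pmap; apply/andP; split; first exact/asboolP.
  by apply/mapP; exists (pickle q); rewrite ?pickleK ?mem_iota.
have {Hc} [Ms HMs] := choice Hc.
have [U [HU HUinf]] := filter.ultraFilterLemma filter.eventually_filter.
have [s Hs] := ultraproduct_sat HU (fun k => projT2 (Ms k)).
have : sat s p.
  apply: Hp => q Tq s'; apply: (@sat_closed _ s); first exact: HT.
  apply/Hs/HUinf; exists (pickle q).+1 => // k /= Hk.
  by have [h _] := HMs k; apply: h.
have /= [HF _] := HU.
move/Hs => HUp; apply: (@filter.filter_not_empty _ U HF).
by rewrite (_ : set0 = fun k => sat (projT2 (Ms k)) p) //;
  apply: funext => k; apply: propext; split=> // /(proj2 (HMs k)).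
Qed.

(** * The standard model that knows the consequences of a theory *)

Lemma entails_mp T p q : entails T (FImp p q) -> entails T p -> entails T q.
Proof. by move=> Hpq Hp M HM s; apply: Hpq => //; apply: Hp. Qed.

Lemma entails_axiom (T : form -> Prop) p : T p -> entails T p.
Proof. by move=> Tp M HM s; apply: HM. Qed.

Lemma entails_alpha T p q : alpha p q -> entails T p <-> entails T q.
Proof. by move=> E; split=> H M HM s; apply/(sat_alpha E); apply: H. Qed.

Lemma assigned_ssub (s : nat -> std_fo) f p :
  free_for f p ->
  {in fv p, forall y, ssubt (fun z => num (s z)) (f y) = num (evalt s (f y))} ->
  assigned s (ssub f p) = assigned (fun y => evalt s (f y)) p.
Proof. by move=> Hf Hn; rewrite /assigned ssub_comp //; apply: eq_ssub. Qed.

Lemma fv_assigned s p : fv (assigned s p) = [::].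
Proof.
case E: (fv _) => [//|y ys].
have /(fv_ssub_tame (@tame_num s)) : y \in fv (assigned s p).
  by rewrite E inE eqxx.
by rewrite fvt_num andbF.
Qed.

(** For any [T], reading [K(p)] under [s] as the entailment of [p^s] satisfies
    the conditions on structures: the sentences [p^s] involved are equal, or
    equal up to renaming of bound variables. *)
Section Knower.

Variable T : form -> Prop.

Let knower_know p (s : nat -> std_fo) : Prop := entails T (assigned s p).

Let knower_fv p (s s' : nat -> std_fo) :
  {in fv p, s =1 s'} -> knower_know p s <-> knower_know p s'.
Proof.
move=> H; rewrite /knower_know /assigned.
by rewrite (@eq_ssub _ (fun y => num (s' y))) // => y Hy; rewrite H.
Qed.

Let knower_alpha p q (s : nat -> std_fo) :
  alpha p q -> knower_know p s <-> knower_know q s.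
Proof. by move=> H; apply/entails_alpha/alpha_ssub/H/tame_num. Qed.

Let knower_subst p x y (s : nat -> std_fo) :
  substitutable x (TVar y) p ->
  knower_know (subst x (TVar y) p) s <-> knower_know p (upd s x (s y)).
Proof.
move=> H; rewrite /knower_know /subst assigned_ssub ?substitutable_free_for //.
  rewrite (_ : (fun z => _) = upd s x (s y)) //.
  by apply: funext => z; rewrite /upd; case: eqP.
by move=> z _; rewrite /upd; case: eqP.
Qed.

Definition knower : structure := Structure knower_fv knower_alpha knower_subst.

Lemma sat_knower_know p (s : nat -> knower) :
  sat s (FKnow p) <-> entails T (assigned s p).
Proof. by []. Qed.

(** Knowledge is a matter of syntax: [K(p(y|f y))] under [s] is about the terms
    obtained from [f y], and can be compared with [K(p)] only if these are
    literally numerals.  Zero, successors of variables and numerals qualify;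
    a sum of two variables does not. *)
Definition numeral_valued (f : nat -> term) : Prop :=
  forall (s : nat -> std_fo) y,
    ssubt (fun z => num (s z)) (f y) = num (evalt s (f y)).

Lemma sat_knower_ssub f p (s : nat -> knower) :
  tame f -> numeral_valued f ->
  sat s (ssub f p) <-> @sat knower (fun y => @evalt std_fo s (f y)) p.
Proof.
elim: p f s => /= [t u|p IH|p IHp q IHq|x p IH|p IH] f s Hf Hn.
- have E w : @evalt std_fo s (ssubt f w)
             = @evalt std_fo (fun y => @evalt std_fo s (f y)) w.
    by elim: w => //= [w ->|w -> w' ->|w -> w' ->].
  by rewrite !E.
- by rewrite IH.
- by rewrite IHp ?IHq.
- have E a : @sat knower (upd s x a) (ssub (upd f x (TVar x)) p) <->
      @sat knower (upd (fun y => @evalt std_fo s (f y)) x a) p.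
    rewrite IH; last 2 first.
    + exact: tame_upd.
    + by move=> s' y; rewrite /upd; case: eqP.
    apply: eq_sat => y _; rewrite /upd; case: (y =P x) => [_|/eqP ne] /=.
      by rewrite eqxx.
    apply: (@eq_evalt std_fo) => z /Hf; rewrite inE => /eqP->.
    by rewrite (negbTE ne).
  by split=> H a; apply/E.
- rewrite -/(assigned s p) /knower_know assigned_ssub //.
  exact: tame_free_for.
Qed.

Lemma numeral_valued_subst x t :
  (forall s : nat -> std_fo,
    ssubt (fun z => num (s z)) t = num (evalt s t)) ->
  numeral_valued (upd TVar x t).
Proof. by move=> Ht s y; rewrite /upd; case: eqP. Qed.

Lemma tame_subst x t : {subset fvt t <= [:: x]} -> tame (upd TVar x t).
Proof. by move=> Ht y z; rewrite /upd; case: eqP => [->|_]; [apply: Ht|]. Qed.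

Lemma ssubt_num f m : ssubt f (num m) = num m.
Proof. by elim: m => //= m ->. Qed.

Lemma evalt_num (s : nat -> std_fo) m : evalt s (num m) = m.
Proof. by elim: m => //= m ->. Qed.

Lemma sat_knower_subst x t p (s : nat -> knower) :
  {subset fvt t <= [:: x]} ->
  (forall s : nat -> std_fo,
    ssubt (fun z => num (s z)) t = num (evalt s t)) ->
  sat s (subst x t p) <-> @sat knower (upd s x (@evalt std_fo s t)) p.
Proof.
move=> Ht Hn; rewrite sat_knower_ssub; last 2 first.
- exact: tame_subst.
- exact: numeral_valued_subst.
by apply: eq_sat => y _; rewrite /upd; case: eqP.
Qed.

Lemma sat_knower_subst_num x m p (s : nat -> knower) :
  sat s (subst x (num m) p) <-> @sat knower (upd s x m) p.
Proof.
rewrite sat_knower_subst ?fvt_num ?evalt_num // => s'.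
by rewrite ssubt_num evalt_num.
Qed.

Lemma sat_knower_assigned p (s s' : nat -> knower) :
  sat s' (assigned s p) <-> sat s p.
Proof.
rewrite sat_knower_ssub; last 2 first.
- exact: tame_num.
- by move=> s'' y; rewrite ssubt_num evalt_num.
by apply: eq_sat => y _; rewrite evalt_num.
Qed.

Lemma sat_knower_std p (s : nat -> knower) :
  know_free p -> sat s p <-> std_sat s p.
Proof.
elim: p s => //= [p IH|p IHp q IHq|x p IH] s H.
- by rewrite IH.
- by case/andP: H => Hp Hq; rewrite IHp ?IHq.
- by split=> Ha a; apply/IH.
Qed.

(** The induction schema holds for all formulas, including those with [K]: the
    only terms substituted are [TZero] and [TSucc (TVar x)], and the domain is
    the set of natural numbers. *)
Lemma knower_EA p (s : nat -> knower) : EA_axiom p -> sat s p.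
Proof.
case=> {p} [p q Hp Hq|x p q Hq]; apply: (sat_closure Hq) => {q Hq} {}s.
- case: Hp => /=.
  + by [].
  + by case.
  + exact: addn0.
  + exact: addnS.
  + exact: muln0.
  + by rewrite mulnSr.
- rewrite /= sat_knower_subst // => H0 HS; elim=> [|a IH]; first exact: H0.
  have /= := HS a IH; rewrite sat_knower_subst /=; last 2 first.
  + by [].
  + by move=> s'; rewrite /=.
  apply eq_sat => y _; rewrite /upd eqxx.
  by case: (y == x).
Qed.

End Knower.

(** * The theory of the knowing machine *)

Section Machine.

Variables (x : nat) (inW : nat -> form -> form) (n : nat).
Hypothesis hinW : expresses_membership x inW.

Let T := S'0 x inW n.

Lemma fv_having_code p : fv p =i [:: x] -> fv (having_code x inW n p) = [::].
Proof.
have [_ fvW _] := hinW n p => fvp.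
rewrite /having_code /=; case E: [seq _ <- _ | _] => [//|y ys].
have : y \in y :: ys by rewrite inE eqxx.
rewrite -E mem_filter !mem_cat !fvW !fvp !inE.
by case: (y == x).
Qed.

Lemma fv_EA p : EA_axiom p -> fv p = [::].
Proof. by case=> [? ? _|? ? ?] /fv_closure. Qed.

Lemma fv_S'0_base p : S'0_base x inW n p -> fv p = [::].
Proof.
elim=> {p}; try by move=> *; apply: fv_closure; eassumption.
- exact: fv_EA.
- exact: fv_having_code.
- by [].
Qed.

Lemma fv_S'0 p : T p -> fv p = [::].
Proof.
by elim=> {p} [p /fv_S'0_base|p s _|p _] //; apply: fv_assigned.
Qed.

(** Compactness turns the entailment of [p] into a valid implication from
    members of [T]; [T] contains [K] of that implication and of its premises,
    and distributing [K] removes the premises one at a time. *)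
Lemma S'0_necessitation p :
  fv p = [::] -> entails T p -> entails T (FKnow p).
Proof.
move=> fvp Tp; have [ps Tps Hps] := compactness fv_S'0 Tp.
have : entails T (FKnow (foldr FImp p ps)).
  apply/entails_axiom/S'0_I/(S'0_valid _ _ _ Hps)/closure_closed.
  by apply: fv_imps => // q /Tps /fv_S'0.
elim: ps Tps {Hps} => //= q ps IH Tps H.
have fvps : fv (foldr FImp p ps) = [::].
  by apply: fv_imps => // r Hr; apply/fv_S'0/Tps; rewrite inE Hr orbT.
have Tq : T q by apply: Tps; rewrite inE eqxx.
apply: IH => // [r Hr|]; first by apply: Tps; rewrite inE Hr orbT.
apply: entails_mp (entails_axiom (S'0_III Tq)).
apply: entails_mp H; apply/entails_axiom/S'0_I.
apply: (@S'0_distr _ _ _ q (foldr FImp p ps)).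
by apply: closure_closed; rewrite /= (fv_S'0 Tq) fvps.
Qed.

Let N := knower T.

Let N_know_closed p (s : nat -> N) :
  fv p = [::] -> sat s (FKnow p) <-> entails T p.
Proof. by move=> fvp; rewrite sat_knower_know /assigned ssub_closed. Qed.

Hypothesis hn : forall z : nat,
  W n z <->
  exists (m : nat) (p : form),
    [/\ z = pair_code m (gn p), {subset fv p <= [:: x]} &
        entails T (subst x (num m) p)].

(** The hypothesis on [n] makes [K(p)] and membership in [W_n] the same
    condition: [p] has [x] as its only free variable, so [p^s] is [p(x|m)] with
    [m] the value of [x]. *)
Lemma knower_having_code p (s : nat -> N) :
  fv p =i [:: x] -> sat s (having_code x inW n p).
Proof.
move=> fvp a; have [Wfree _ Wstd] := hinW n p.
suff E : sat (upd s x a : nat -> N) (FKnow p)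
         <-> sat (upd s x a : nat -> N) (inW n p).
  by move=> /= H; apply: H => /E.
rewrite sat_knower_know sat_knower_std // Wstd hn /upd eqxx.
have -> : assigned (fun y => if y == x then a else s y) p = subst x (num a) p.
  by apply: eq_ssub => y; rewrite fvp inE /upd => /eqP->; rewrite eqxx.
split=> [H|[m [q [E _ H]]]].
  by exists a, p; split=> // y; rewrite fvp.
case: (Cantor.to_nat_inj _ _ E) => -> Epq.
by rewrite (pcan_inj pickleK Epq).
Qed.

(** In the case of [K(p) -> K(K(p))], the truth of [K(K(p))] in the structure
    means that [T] entails [K(p^s)]. *)
Lemma knower_base q (s : nat -> N) : S'0_base x inW n q -> sat s q.
Proof.
move=> H; elim: H s => {q}.
- move=> p q r Hr; apply: (sat_closure Hr) => s.
  rewrite /K_distr /= -!/(entails T _); exact: entails_mp.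
- move=> p q Hq; apply: (sat_closure Hq) => s.
  exact: S'0_necessitation (fv_assigned _ _).
- move=> p Hp s; exact: knower_EA.
- move=> p fvp s; exact: knower_having_code.
- move=> p q Hp Hq; apply: (sat_closure Hq) => s.
  exact/entails_axiom/S'0_assigned_validity.
- move=> p Hp _ s; apply/N_know_closed; first exact: fv_S'0_base Hp.
  exact/entails_axiom/S'0_I.
Qed.

Lemma knower_S'0 q (s : nat -> N) : T q -> sat s q.
Proof.
move=> H; elim: H s => {q}.
- by move=> p Hp s; apply: knower_base.
- by move=> p s Hp s'; apply/sat_knower_assigned/Hp.
- by move=> p Tp _ s; apply/N_know_closed/entails_axiom => //; apply: fv_S'0.
Qed.

Lemma knower_entails q (s : nat -> N) : entails T q -> sat s q.
Proof. by apply=> r Tr s'; apply: knower_S'0. Qed.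

Lemma knower_known p (s : nat -> N) : entails T (assigned s p) -> sat s p.
Proof. by move/(knower_entails s)/sat_knower_assigned. Qed.

Lemma S_global_S'0 p : S_global x inW n p -> T p.
Proof.
move=> H; apply: S'0_I; case: H => {p}.
- exact: S'0_distr.
- exact: S'0_KK.
- exact: S'0_EA.
- exact: S'0_code.
Qed.

(** The premise on all [k <= i] is that of global necessitation: modus ponens by
    itself may use earlier lines that rest on the local axioms, about which [T]
    says nothing. *)
Lemma entails_S_line_global l i (s : nat -> nat) :
  (forall k, k <= i -> S_line_global x inW n l k) ->
  entails T (assigned s (line l i)).
Proof.
elim/ltn_ind: i s => i IH s Hl.
have {}IH j s' : j < i -> entails T (assigned s' (line l j)).
  by move=> ji; apply: IH => // k kj; apply/Hl/(leq_trans kj)/ltnW.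
case: {Hl} (Hl i (leqnn i)) IH => {i} i.
- move=> /S_global_S'0 Ti _.
  by rewrite /assigned ssub_closed ?fv_S'0 //; apply: entails_axiom.
- by move=> Hi _; apply/entails_axiom/S'0_assigned_validity.
- move=> j k ji ki E IH; have := IH k s ki; rewrite E => /entails_mp.
  by apply; apply: IH.
- move=> j ji -> _ IH.
  exact: S'0_necessitation (fv_assigned _ _) (IH j s ji).
Qed.

(** Truth in the structure is enough for local axioms and modus ponens, but
    necessitation needs the stronger entailment from [T]. *)
Lemma knower_S_proves p (s : nat -> N) : S_proves x inW n p -> sat s p.
Proof.
case=> l; set l' := rcons l p => Hl.
suff H i : i < size l' -> forall s : nat -> N, sat s (line l' i).
  have := H (size l); rewrite size_rcons leqnn /line nth_rcons ltnn eqxx.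
  exact.
elim/ltn_ind: i => i IH Hi {}s.
have {}IH j : j < i -> forall s : nat -> N, sat s (line l' j).
  by move=> ji; apply: IH => //; apply: ltn_trans Hi.
case: (Hl i Hi) => [[q r Hr]|].
  by apply: (sat_closure Hr) => s' /sat_knower_know /knower_known.
move=> H; case: H IH => {Hi} {}i.
- by move=> /S_global_S'0 Ti _; apply: knower_S'0.
- by move=> Hi _; apply: Hi.
- move=> j k ji ki E IH; have := IH k ki s; rewrite E; apply; exact: IH.
- move=> j _ -> Hj _; apply/sat_knower_know; exact: entails_S_line_global.
Qed.

End Machine.

Theorem theorem5p4 (x : nat) (inW : nat -> form -> form)
    (hinW : expresses_membership x inW) (n : nat)
    (hn : forall z : nat,
        W n z <->
        exists (m : nat) (p : form),
          [/\ z = pair_code m (gn p),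
              {subset fv p <= [:: x]} &
              entails (S'0 x inW n) (subst x (num m) p)]) :
  S_omega_consistent x inW n.
Proof.
case=> p [y [_ Hex Hall]].
pose s : nat -> knower (S'0 x inW n) := fun _ => 0.
have /= := knower_S_proves hinW hn s Hex; apply=> a; apply.
apply/sat_knower_subst_num; exact: (knower_S_proves hinW hn s (Hall a)).
Qed.
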